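(* Let $(X,d)$ be a compact metric space and $\boldsymbol f=\{f_i\}_{i=1}^\infty$ a periodic sequence of continuous self-maps of $X$ with period $m\in\mathbb N$, that is, $f_{n+m}=f_n$ for all $n\in\mathbb N$. Then for any $Z\subseteq X$, $\varphi\in C(X,\mathbb R)$ and $\theta\in[0,1]$, $$\underline P(\boldsymbol f^m,Z,S_m\varphi,\theta)=m\,\underline P(\boldsymbol f,Z,\varphi,\theta),\qquad \overline P(\boldsymbol f^m,Z,S_m\varphi,\theta)=m\,\overline P(\boldsymbol f,Z,\varphi,\theta),$$ where $\underline P,\overline P$ denote the lower and upper $\theta$-intermediate topological pressures.
   Context: Pressures take values in $[-\infty,+\infty]$. $C(X,\mathbb R)$ is the space of continuous real functions on $X$. For a sequence $\boldsymbol f=\{f_i\}_{i\ge1}$ of continuous self-maps put $f_i^0=\mathrm{id}_X$, $f_i^n=f_{i+n-1}\circ\cdots\circ f_i$, and $S_n\varphi(x)=S_n^{\boldsymbol f}\varphi(x)=\sum_{j=0}^{n-1}\varphi(f_1^j x)$. $\boldsymbol f^m$ denotes the sequence of maps $\{f_{im+1}^m\}_{i=0}^\infty$; in $\underline P(\boldsymbol f^m,Z,S_m\varphi,\theta)$ the potential is $S_m\varphi=S_m^{\boldsymbol f}\varphi$ and the pressure is that of the system $\boldsymbol f^m$. $\mathbb N$ is the set of positive integers. For a finite open cover $\mathcal U$ of $X$, $\mathcal S_m(\mathcal U)$ is the set of strings $\mathbf U=(U_0,\dots,U_{m-1})$ with all $U_j\in\mathcal U$; $m(\mathbf U)=m$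 is the length of $\mathbf U$; and $X_{\boldsymbol f}(\mathbf U)=\{x\in X: f_1^j(x)\in U_j,\ 0\le j\le m-1\}$. For $Z\subseteq X$, $\alpha\in\mathbb R$, $N\in\mathbb N$, $\theta\in[0,1]$ let $$M(Z,\alpha,\varphi,\mathcal U,N,\theta)=\inf_{\mathcal G}\sum_{\mathbf U\in\mathcal G}\exp\Bigl(-\alpha m(\mathbf U)+\sup_{x\in X_{\boldsymbol f}(\mathbf U)}S^{\boldsymbol f}_{m(\mathbf U)}\varphi(x)\Bigr),$$ the infimum over all finite or countable collections $\mathcal G$ of strings of lengths $m$ with $N\le m<N/\theta+1$ (for $\theta=0$: $m\ge N$) such that $Z\subseteq\bigcup_{\mathbf U\in\mathcal G}X_{\boldsymbol f}(\mathbf U)$; the supremum over an empty set is $-\infty$ (so the term is $0$). Let $\underline m$ and $\overline m$ be the $\liminf$ and $\limsup$ of $M(Z,\alpha,\varphi,\mathcal U,N,\theta)$ as $N\to\infty$, and $$\underline P(\boldsymbol f,Z,\varphi,\mathcal U,\theta)=\inf\{\alpha:\underline m=0\}=\sup\{\alpha:\underline m=\infty\},\quad \overline P(\boldsymbol f,Z,\varphi,\mathcal U,\theta)=\inf\{\alpha:\overline m=0\}=\sup\{\alpha:\overline m=\infty\}.$$ With $|\mathcal U|=\max_{U\in\mathcal U}\operatorname{diam}U$, the lower and upper $\theta$-intermediate topological pressures are $\underline P(\boldsymbol f,Z,\varphi,\theta)=\lim_{|\mathcal U|\to0}\underline P(\boldsymbol f,Z,\varphi,\mathcal U,\theta)$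 and $\overline P(\boldsymbol f,Z,\varphi,\theta)=\lim_{|\mathcal U|\to0}\overline P(\boldsymbol f,Z,\varphi,\mathcal U,\theta)$ (these limits exist). *)

(* Defs.v *)
From HB Require Import structures.
From mathcomp Require Import all_boot all_order all_algebra.
From mathcomp Require Import all_classical all_reals all_analysis.

Set Implicit Arguments.
Unset Strict Implicit.
Unset Printing Implicit Defensive.

Import Order.TTheory GRing.Theory Num.Theory.
Import numFieldNormedType.Exports.

Local Open Scope classical_set_scope.
Local Open Scope ring_scope.

(* A sequence (f_i)_{i >= 1} of self-maps is encoded as f : nat -> X -> X with
   the index shifted by one: f i stands for f_{i+1}. *)

(* compn f i n = f (i + n - 1) \o ... \o f i, i.e. f_{i+1}^n. *)
Fixpoint compn (X : Type) (f : nat -> X -> X) (i n : nat) : X -> X :=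
  if n is k.+1 then f (i + k)%N \o compn f i k else id.

(* The sequence {f_{im+1}^m}_{i >= 0}. *)
Definition fpow (X : Type) (f : nat -> X -> X) (m : nat) : nat -> X -> X :=
  fun i => compn f (i * m)%N m.

Definition birkhoff (R : realType) (X : Type) (f : nat -> X -> X)
    (phi : X -> R) (n : nat) : X -> R :=
  fun x => \sum_(j < n) phi (compn f 0 j x).

Definition finite_open_cover (X : topologicalType) (U : set (set X)) : Prop :=
  [/\ finite_set U, (forall A, U A -> open A) & \bigcup_(A in U) A = setT].

(* The 0 makes the diameter of the empty set equal to 0. *)
Definition diam (R : realType) (X : metricType R) (A : set X) : \bar R :=
  maxe 0%E (ereal_sup [set (mdist p.1 p.2)%:E | p in A `*` A]).

(* The supremum is a maximum, U being finite; it is -oo for U = set0, which is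
   a cover only when X is empty. *)
Definition mesh (R : realType) (X : metricType R) (U : set (set X)) : \bar R :=
  ereal_sup [set diam A | A in U].

(* The filter "|U| -> 0" on finite open covers. *)
Definition mesh_to0 (R : realType) (X : metricType R) :
    set_system (set (set X)) :=
  filter_from [set delta : R | 0 < delta]
    (fun delta => [set U | finite_open_cover U /\ (mesh U < delta%:E)%E]).

Global Instance mesh_to0_filter (R : realType) (X : metricType R) :
  Filter (@mesh_to0 R X).
Proof.
apply: filter_from_filter; first by exists 1 => /=.
move=> a b /= a0 b0; exists (Order.min a b) => /=; first by rewrite lt_min a0 b0.
by move=> U [cU]; rewrite EFin_min lt_min => /andP[Ua Ub].
Qed.

(* A string (U_0, ..., U_{m-1}) is a sequence s : seq (set X), of length
   m(s) = size s. *)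
Definition string_in (X : Type) (U : set (set X)) (s : seq (set X)) : Prop :=
  forall j, (j < size s)%N -> U (nth set0 s j).

Definition string_set (X : Type) (f : nat -> X -> X) (s : seq (set X)) :
    set X :=
  [set x | forall j, (j < size s)%N -> nth set0 s j (compn f 0 j x)].

(* N <= m < N / theta + 1, the upper bound being void for theta = 0. *)
Definition admissible_length (R : realType) (N : nat) (theta : R) (m : nat) :
    Prop :=
  (N <= m)%N /\ (theta != 0 -> m%:R < N%:R / theta + 1).

Definition admissible (R : realType) (X : Type) (f : nat -> X -> X)
    (Z : set X) (U : set (set X)) (N : nat) (theta : R)
    (G : set (seq (set X))) : Prop :=
  [/\ countable G,
      forall s, G s -> string_in U s /\ admissible_length N theta (size s) &
      Z `<=` \bigcup_(s in G) string_set f s].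

(* expeR -oo = 0, so strings with empty string_set contribute 0. *)
Definition string_weight (R : realType) (X : Type) (f : nat -> X -> X)
    (alpha : R) (phi : X -> R) (s : seq (set X)) : \bar R :=
  expeR ((- (alpha * (size s)%:R))%:E +
    ereal_sup [set (birkhoff f phi (size s) x)%:E | x in string_set f s])%E.

Definition premeasure (R : realType) (X : Type) (f : nat -> X -> X)
    (Z : set X) (alpha : R) (phi : X -> R) (U : set (set X)) (N : nat)
    (theta : R) : \bar R :=
  ereal_inf [set (\esum_(s in G) string_weight f alpha phi s)%E
            | G in admissible f Z U N theta].

Definition lower_pressure_cover (R : realType) (X : Type) (f : nat -> X -> X)
    (Z : set X) (phi : X -> R) (theta : R) (U : set (set X)) : \bar R :=
  ereal_inf [set alpha%:E | alpha in [set alpha : R |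
    limn_einf (fun N => premeasure f Z alpha phi U N theta) = 0%E]].

Definition upper_pressure_cover (R : realType) (X : Type) (f : nat -> X -> X)
    (Z : set X) (phi : X -> R) (theta : R) (U : set (set X)) : \bar R :=
  ereal_inf [set alpha%:E | alpha in [set alpha : R |
    limn_esup (fun N => premeasure f Z alpha phi U N theta) = 0%E]].

Definition lower_pressure (R : realType) (X : metricType R)
    (f : nat -> X -> X) (Z : set X) (phi : X -> R) (theta : R) : \bar R :=
  lim (lower_pressure_cover f Z phi theta U @[U --> @mesh_to0 R X]).

Definition upper_pressure (R : realType) (X : metricType R)
    (f : nat -> X -> X) (Z : set X) (phi : X -> R) (theta : R) : \bar R :=
  lim (upper_pressure_cover f Z phi theta U @[U --> @mesh_to0 R X]).

(* Main.v *)
(* Write g for f^m, psi for S_m phi, and for a cover U let V be the cover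
   block_cover f m U by the sets X_f(U_0, ..., U_{m-1}).  Since f is periodic, a
   g-string over V is a block decomposition of an f-string over U of length a
   multiple of m; the two define the same set, and their weights for the
   exponents m * alpha and alpha agree.  Strings of other lengths are extended
   by boundedly many entries in all possible ways, which costs a constant factor
   and, because the admissible lengths are N <= n < N / theta + 1, can be done
   within the admissible range after adjusting N by O(m).  Hence
   P(g, Z, psi, V, theta) = m * P(f, Z, phi, U, theta) for every single cover U,
   and V is at least as fine as U.  The limit over covers exists by the usual
   argument: if V is subordinate to U and the potential oscillates by at most e on
   the members of U, then P(., U, .) <= P(., V, .) + e. *)

Require Import Defs.
From mathcomp Require Import all_boot all_order all_algebra.
From mathcomp Require Import all_classical all_reals all_analysis.
From mathcomp Require Import zify ring lra.

Import Order.TTheory GRing.Theory Num.Theory.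
Import numFieldNormedType.Exports.

Local Open Scope classical_set_scope.
Local Open Scope ring_scope.

Set Implicit Arguments.
Unset Strict Implicit.

(** * Strings and their block decompositions *)

Definition strings (X : Type) (U : set (set X)) (n : nat) : set (seq (set X)) :=
  [set s | string_in U s /\ size s = n].

Definition block_cover (X : Type) (f : nat -> X -> X) (m : nat)
    (U : set (set X)) : set (set X) :=
  string_set f @` strings U m.

Lemma string_in_cat (X : Type) (U : set (set X)) (s t : seq (set X)) :
  string_in U s -> string_in U t -> string_in U (s ++ t).
Proof.
move=> sU tU j; rewrite size_cat nth_cat => jst.
by case: ltnP => js; [exact: sU|apply: tU; rewrite ltn_subLR].
Qed.

Lemma string_in_take (X : Type) (U : set (set X)) (n : nat) (s : seq (set X)) :
  string_in U s -> string_in U (take n s).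
Proof.
move=> sU j; rewrite size_take_min leq_min => /andP[jn js].
by rewrite nth_take//; exact: sU.
Qed.

Lemma finite_strings (X : Type) (U : set (set X)) (n : nat) :
  finite_set U -> finite_set (strings U n).
Proof.
move=> finU; elim: n => [|n IH].
  apply: (@sub_finite_set _ _ [set [::]]) => // s [_ s0] /=.
  exact/size0nil.
apply: (@sub_finite_set _ _
  ((fun p => p.1 :: p.2) @` (U `*` strings U n))); last first.
  exact/finite_image/finite_setX.
move=> [|A s] [sU //= [sn]]; exists (A, s) => //=; split; first exact: (sU 0%N).
by split => // j js; exact: (sU j.+1).
Qed.

Lemma string_setP (X : Type) (f : nat -> X -> X) (n : nat) (s t : seq (set X))
    (x : X) : size s = n ->
  string_set f (s ++ t) x <->
  string_set f s x /\
  forall j, (j < size t)%N -> nth set0 t j (compn f 0 (n + j) x).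
Proof.
move=> sn; split=> [h|[h1 h2] j].
  split=> j jl.
    by have := h j; rewrite size_cat nth_cat jl; apply; exact: ltn_addr.
  have := h (n + j)%N; rewrite size_cat nth_cat sn ltn_add2l addKn.
  by rewrite (_ : (n + j < n)%N = false); [apply|lia].
rewrite size_cat nth_cat sn => jl; case: ltnP => jn.
  by apply: h1; rewrite sn.
by have := h2 (j - n)%N; rewrite subnKC//; apply; rewrite ltn_subLR.
Qed.

Section periodic.
Context (X : Type) (f : nat -> X -> X) (m : nat).
Hypothesis hper : forall n, f (n + m)%N = f n.

Let F := compn f 0 m.

(** By definition maps are added on the outside; periodicity allows the first block [F] to be split
    off on the inside instead. *)
Lemma compn_period (n : nat) : compn f 0 (m + n) = compn f 0 n \o F.
Proof.
elim: n => [|n IH]; first by rewrite addn0.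
by rewrite addnS /= IH !add0n addnC hper.
Qed.

Lemma fpow_period (i : nat) : fpow f m i = F.
Proof.
have fE k : f (i * m + k)%N = f k.
  by elim: i => // i IH; rewrite mulSn -addnA addnC hper.
by rewrite /fpow /F; elim: {2 3}m => //= k ->; rewrite fE add0n.
Qed.

Lemma compn_fpow (k : nat) : compn (fpow f m) 0 k = compn f 0 (k * m).
Proof.
have gS j : compn (fpow f m) 0 j.+1 = F \o compn (fpow f m) 0 j.
  by rewrite /= fpow_period.
(* All maps of the power system equal [F], so a factor can also be peeled off on the inside, where
   [compn_period] needs it. *)
have gSr j : compn (fpow f m) 0 j.+1 = compn (fpow f m) 0 j \o F.
  by elim: j => [|j IH]; rewrite gS// [in RHS]gS IH.
by elim: k => // k IH; rewrite gSr IH mulSn compn_period.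
Qed.

(** Induction on the blocks: the first block constrains [x] during times [j < m], and the remaining
    ones are the same kind of condition on [F x]. *)
Lemma string_set_fpow_flatten (ss : seq (seq (set X))) :
  (forall s, s \in ss -> size s = m) ->
  string_set (fpow f m) (map (string_set f) ss) = string_set f (flatten ss).
Proof.
elim: ss => [_|s ss IH sm]; first by apply/seteqP; split => x _ j.
have szs : size s = m by apply: sm; rewrite mem_head.
have {}IH := IH (fun t ht => sm t (mem_behead (s := s :: ss) ht)).
have IHx y := congr1 (fun A : set X => A y) IH.
have gP x := @string_setP X (fpow f m) 1 [:: string_set f s]
  (map (string_set f) ss) x erefl.
apply/seteqP; split => x /=.
- move=> /gP[h1 h2]; apply/(string_setP _ _ _ szs); split.
    exact: (h1 0%N).
  have : string_set f (flatten ss) (F x).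
    by rewrite -IHx => i /h2; rewrite !compn_fpow mulSn compn_period.
  by move=> h j /h; rewrite compn_period.
- move=> /(string_setP _ _ _ szs)[h1 h2]; apply/gP; split; first by case.
  have : string_set f (flatten ss) (F x) by move=> j /h2; rewrite compn_period.
  by rewrite -IHx => h i /h; rewrite !compn_fpow mulSn compn_period.
Qed.

Lemma birkhoff_period (R : realType) (phi : X -> R) (n : nat) (x : X) :
  birkhoff f phi (m + n) x = birkhoff f phi m x + birkhoff f phi n (F x).
Proof.
rewrite /birkhoff big_split_ord; congr (_ + _).
by apply: eq_bigr => i _ /=; rewrite compn_period.
Qed.

Lemma birkhoff_fpow (R : realType) (phi : X -> R) (k : nat) (x : X) :
  birkhoff (fpow f m) (birkhoff f phi m) k x = birkhoff f phi (k * m) x.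
Proof.
elim: k x => [|k IH] x; first by rewrite /birkhoff !big_ord0.
rewrite mulSn birkhoff_period -IH /birkhoff big_ord_recl; congr (_ + _).
by apply: eq_bigr => i _; rewrite lift0 !compn_fpow mulSn compn_period.
Qed.

Lemma string_weight_fpow_flatten (R : realType) (phi : X -> R) (alpha : R)
    (ss : seq (seq (set X))) :
  (forall s, s \in ss -> size s = m) ->
  string_weight (fpow f m) (m%:R * alpha) (birkhoff f phi m)
    (map (string_set f) ss) = string_weight f alpha phi (flatten ss).
Proof.
move=> sm; have szE : size (flatten ss) = (size ss * m)%N.
  elim: ss sm => // s ss IH sm; rewrite size_cat mulSn sm ?mem_head// IH//.
  by move=> t ht; apply: sm; rewrite inE ht orbT.
rewrite /string_weight string_set_fpow_flatten// szE size_map.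
congr (expeR (_ + ereal_sup _)%E).
  by congr (- _)%:E; rewrite natrM; ring.
by apply: eq_imagel => x _; rewrite birkhoff_fpow.
Qed.

End periodic.

(** * Comparison of premeasures *)

Lemma esum_subset (R : realType) (T : choiceType) (A B : set T)
    (a : T -> \bar R) :
  A `<=` B -> (\esum_(i in A) a i <= \esum_(i in B) a i)%E.
Proof.
move=> AB; apply: ge_ereal_sup => _ [X [finX XA] <-].
by apply: esum_ge; exists X => //; split=> // x /XA/AB.
Qed.

(** Since [e] need not be injective, a section [s] of [e] turns the sum over the image into a sum
    over a subset of [P]. *)
Lemma esum_image_le (R : realType) (T T' : choiceType) (P : set T)
    (e : T -> T') (a : T' -> \bar R) :
  (\esum_(j in e @` P) a j <= \esum_(i in P) a (e i))%E.
Proof.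
have [[i0 _]|P0] := pselect (exists i, P i); last first.
  suff -> : P = set0 by rewrite image_set0 !esum_set0.
  by apply/seteqP; split=> // i Pi; apply: P0; exists i.
pose s j := xget i0 [set i | P i /\ e i = j].
have sP j : (e @` P) j -> P (s j) /\ e (s j) = j.
  move=> [i Pi eij].
  by apply: (@xgetPex _ i0 [set i | P i /\ e i = j]); exists i.
rewrite (@eq_esum _ _ _ _ (fun j => a (e (s j)))); last by move=> j /sP[_ ->].
rewrite -(@esum_image _ _ _ (e @` P) s (fun i => a (e i))); last first.
  by move=> j k /[!inE] /sP[_ ej] /sP[_ ek] jk; rewrite -ej -ek jk.
by apply: esum_subset => _ [j /sP[Pj _] <-].
Qed.

Lemma esumZ_le (R : realType) (T : choiceType) (A : set T) (a : T -> \bar R)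
    (c : R) : 0 <= c -> (forall i, 0 <= a i)%E ->
  (\esum_(i in A) (c%:E * a i) <= c%:E * \esum_(i in A) a i)%E.
Proof.
move=> c0 a0; apply: ge_ereal_sup => _ [X [finX XA] <-].
rewrite -ge0_mule_fsumr//; apply: lee_wpmul2l; first by rewrite lee_fin.
by apply: esum_ge; exists X.
Qed.

Lemma string_weight_ge0 (R : realType) (X : Type) (f : nat -> X -> X)
    (alpha : R) (phi : X -> R) (s : seq (set X)) :
  (0 <= string_weight f alpha phi s)%E.
Proof. exact: expeR_ge0. Qed.

Lemma premeasure_ge0 (R : realType) (X : Type) (f : nat -> X -> X)
    (Z : set X) (alpha : R) (phi : X -> R) (U : set (set X)) (N : nat)
    (theta : R) : (0 <= premeasure f Z alpha phi U N theta)%E.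
Proof.
apply: le_ereal_inf_tmp => _ [G _ <-]; apply: esum_ge0 => s _.
exact: string_weight_ge0.
Qed.

(** The common mechanism of all premeasure comparisons: each string [s] of an admissible family is
    replaced by the strings [h s t], with [t] in a countable index set independent of [s], at the
    price of a factor [C]. *)
Lemma premeasure_transfer (R : realType) (X : Type) (f g : nat -> X -> X)
    (Z : set X) (alpha beta : R) (phi psi : X -> R) (U V : set (set X))
    (N K : nat) (theta : R) (T : choiceType) (D : set T)
    (h : seq (set X) -> T -> seq (set X)) (C : R) :
  countable D -> 0 < C ->
  (forall s, string_in U s -> admissible_length N theta (size s) ->
    string_set f s !=set0 ->
    [/\ forall t, D t ->
          string_in V (h s t) /\ admissible_length K theta (size (h s t)),
        string_set f s `<=` \bigcup_(t in D) string_set g (h s t) &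
        (\esum_(t in D) string_weight g beta psi (h s t)
         <= C%:E * string_weight f alpha phi s)%E]) ->
  (premeasure g Z beta psi V K theta
   <= C%:E * premeasure f Z alpha phi U N theta)%E.
Proof.
move=> cD C0 hh; rewrite -ereal_inf_pZl//.
apply: le_ereal_inf_tmp => _ [_ [G [cG GU ZG] <-] <-].
(* Strings with empty string set cover no point and are dropped, so [h] is only used where a point
   of the string set exists. *)
pose G0 := G `&` [set s | string_set f s !=set0].
have {}hh s : G0 s -> _ := fun Gs => hh s (GU s Gs.1).1 (GU s Gs.1).2 Gs.2.
pose h2 p := h p.1 p.2.
apply: (@le_trans _ _
    (\esum_(s in h2 @` (G0 `*` D)) string_weight g beta psi s)%E).
  apply: ereal_inf_lbound; exists (h2 @` (G0 `*` D)) => //; split.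
  - apply: sub_countable (card_image_le _ _) _; apply: countableX => //.
    by apply: sub_countable cG; apply: subset_card_le; exact: subIsetl.
  - by move=> _ [[s t] [/= /hh[hD _ _] /hD ?] <-].
  - move=> z /ZG[s Gs zs].
    have G0s : G0 s by split => //; exists z.
    have [_ /(_ _ zs)[t Dt zt] _] := hh _ G0s.
    by exists (h s t) => //; exists (s, t).
apply: le_trans (esum_image_le _ _ _) _.
rewrite (_ : G0 `*` D = G0 `*`` (fun=> D)); last by [].
rewrite -(@esum_esum _ _ _ G0 (fun=> D)
  (fun s t => string_weight g beta psi (h s t))); last first.
  by move=> *; exact: string_weight_ge0.
apply: (@le_trans _ _
    (\esum_(s in G0) (C%:E * string_weight f alpha phi s))%E).
  by apply: le_esum => s /hh[].
apply: le_trans (esumZ_le _ (ltW C0) _) _.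
  by move=> s; exact: string_weight_ge0.
apply: lee_wpmul2l; first by rewrite lee_fin ltW.
by apply: esum_subset; exact: subIsetl.
Qed.

Lemma limn_einf_eq0P (R : realType) (u : nat -> \bar R) :
  (forall n, 0 <= u n)%E ->
  limn_einf u = 0%E <->
  forall n (e : R), 0 < e -> exists2 k, (n <= k)%N & (u k < e%:E)%E.
Proof.
move=> u0; rewrite limn_einf_lim (cvg_lim _ (@cvg_einfs_sup _ u))//.
have einfs0 n : (0 <= einfs u n)%E by apply: le_ereal_inf_tmp => _ [k _ <-].
split=> [u_0 n e e0|H].
  have : (einfs u n < e%:E)%E.
    apply: le_lt_trans (_ : 0 < e%:E)%E; last by rewrite lte_fin.
    by rewrite -u_0; apply: ereal_sup_ubound; exists n.
  by move=> /ereal_inf_lt[_ [k nk <-] ke]; exists k.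
apply/eqP; rewrite eq_le; apply/andP; split; last first.
  by apply: le_trans (einfs0 0%N) _; apply: ereal_sup_ubound; exists 0%N.
apply: ge_ereal_sup => _ [n _ <-]; apply/lee_addgt0Pr => e e0; rewrite add0e.
have [k nk /ltW ke] := H n e e0.
by apply: le_trans ke; apply: ereal_inf_lbound; exists k.
Qed.

Lemma limn_esup_eq0P (R : realType) (u : nat -> \bar R) :
  (forall n, 0 <= u n)%E ->
  limn_esup u = 0%E <->
  forall e : R, 0 < e -> exists n, forall k, (n <= k)%N -> (u k < e%:E)%E.
Proof.
move=> u0; rewrite limn_esup_lim (cvg_lim _ (@cvg_esups_inf _ u))//.
have uesups n k : (n <= k)%N -> (u k <= esups u n)%E.
  by move=> nk; apply: ereal_sup_ubound; exists k.
have esups0 n : (0 <= esups u n)%E by apply: le_trans (u0 n) (uesups _ _ _).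
split=> [u_0 e e0|H].
  have /ereal_inf_lt[_ [n _ <-] ne] : (ereal_inf (range (esups u)) < e%:E)%E.
    by rewrite u_0 lte_fin.
  by exists n => k nk; apply: le_lt_trans (uesups _ _ nk) ne.
apply/eqP; rewrite eq_le; apply/andP; split; last first.
  by apply: le_ereal_inf_tmp => _ [n _ <-].
apply/lee_addgt0Pr => e e0; rewrite add0e.
have [n ne] := H e e0.
apply: (@le_trans _ _ (esups u n)); first by apply: ereal_inf_lbound; exists n.
by apply: ge_ereal_sup => _ [k nk <-]; exact/ltW/ne.
Qed.

(** A vanishing lower limit asks for small terms at arbitrarily large indices only, so it is enough
    to carry each small [u k] to one index [sigma k] of [v]. *)
Lemma limn_einf_eq0_transfer (R : realType) (u v : nat -> \bar R)
    (sigma : nat -> nat) (c : R) :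
  0 < c -> (forall n, 0 <= u n)%E -> (forall n, 0 <= v n)%E ->
  (forall n, exists k0, forall k, (k0 <= k)%N -> (n <= sigma k)%N) ->
  (forall k, v (sigma k) <= c%:E * u k)%E ->
  limn_einf u = 0%E -> limn_einf v = 0%E.
Proof.
move=> c0 u0 v0 sigmay vu /(limn_einf_eq0P u0) H; apply/(limn_einf_eq0P v0).
move=> n e e0; have [k0 hk0] := sigmay n.
have [|k k0k] := H k0 (c^-1 * e); first by rewrite mulr_gt0 ?invr_gt0.
rewrite EFinM lte_pdivlMl// => ke.
exists (sigma k); first exact: hk0.
exact: le_lt_trans (vu k) ke.
Qed.

(** A vanishing upper limit asks for small terms at all large indices, so here every index [n] of
    [v] needs a source [tau n]: the reindexing runs opposite to [sigma]. *)
Lemma limn_esup_eq0_transfer (R : realType) (u v : nat -> \bar R)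
    (tau : nat -> nat) (n0 : nat) (c : R) :
  0 < c -> (forall n, 0 <= u n)%E -> (forall n, 0 <= v n)%E ->
  (forall k, exists n1, forall n, (n1 <= n)%N -> (k <= tau n)%N) ->
  (forall n, (n0 <= n)%N -> v n <= c%:E * u (tau n))%E ->
  limn_esup u = 0%E -> limn_esup v = 0%E.
Proof.
move=> c0 u0 v0 tauy vu /(limn_esup_eq0P u0) H; apply/(limn_esup_eq0P v0).
move=> e e0; have [|k hk] := H (c^-1 * e); first by rewrite mulr_gt0 ?invr_gt0.
have [n1 hn1] := tauy k; exists (maxn n0 n1) => n.
rewrite geq_max => /andP[n0n n1n]; apply: le_lt_trans (vu _ n0n) _.
by have := hk _ (hn1 _ n1n); rewrite EFinM lte_pdivlMl.
Qed.

(** * Premeasures of the power system *)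

Lemma string_inP (X : Type) (U : set (set X)) (s : seq (set X)) :
  string_in U s <-> forall A, A \in s -> U A.
Proof.
split=> [sU A /(nthP set0)[j js <-]|sU j js]; first exact: sU.
exact/sU/mem_nth.
Qed.

(** The orbit of a point after time [size s] selects the added entries. They are truncations of
    strings of fixed length [r], which keeps the index set independent of [s], as
    [premeasure_transfer] requires. *)
Lemma string_set_extensions (X : Type) (f : nat -> X -> X) (U : set (set X))
    (r j : nat) (s : seq (set X)) : \bigcup_(A in U) A = setT ->
  string_set f s `<=` \bigcup_(t in strings U r) string_set f (s ++ take j t).
Proof.
move=> UT x sx.
have /choice[A hA] i : exists A, U A /\ A (compn f 0 i x).
  have : (\bigcup_(A in U) A) (compn f 0 i x) by rewrite UT.
  by move=> [A UA Ax]; exists A.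
pose t := mkseq (fun i => A (size s + i)%N) r.
exists t.
  split; last exact: size_mkseq.
  by move=> i; rewrite size_mkseq => ir; rewrite nth_mkseq//; exact: (hA _).1.
apply/(string_setP _ _ _ erefl); split => // i.
rewrite size_take_min size_mkseq leq_min => /andP[ij ir].
by rewrite nth_take// nth_mkseq//; exact: (hA _).2.
Qed.

Section extensions.
Context (R : realType) (X : Type) (f : nat -> X -> X) (phi : X -> R) (B : R).
Hypothesis B0 : 0 <= B.
Hypothesis phiB : forall x, `|phi x| <= B.
Variable alpha : R.

(** Each added entry raises the exponent by at most [|alpha| + B], and the supremum is taken over a
    smaller set. *)
Lemma string_weight_cat (s t : seq (set X)) :
  (string_weight f alpha phi (s ++ t) <=
   (expR ((`|alpha| + B) * (size t)%:R))%:E * string_weight f alpha phi s)%E.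
Proof.
rewrite /string_weight -[(expR _)%:E]/(expeR _%:E) -expeRD lee_expeR.
rewrite addeA -EFinD size_cat natrD.
apply: (@le_trans _ _ ((- (alpha * ((size s)%:R + (size t)%:R)))%:E +
  ((B * (size t)%:R)%:E + ereal_sup [set (birkhoff f phi (size s) x)%:E
      | x in string_set f s]))%E).
  rewrite leeD2l//; apply: ge_ereal_sup.
  move=> _ [x /(string_setP _ _ _ erefl)[xs _] <-].
  apply: (@le_trans _ _ ((B * (size t)%:R)%:E +
      (birkhoff f phi (size s) x)%:E)%E); last first.
    by rewrite leeD2l//; apply: ereal_sup_ubound; exists x.
  rewrite -EFinD lee_fin /birkhoff big_split_ord /= addrC lerD2r.
  apply: le_trans (_ : \sum_(i < size t) B <= _).
    by apply: ler_sum => i _; exact: le_trans (ler_norm _) (phiB _).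
  by rewrite sumr_const card_ord mulr_natr.
rewrite addeA -EFinD leeD2r// lee_fin.
have : - alpha * (size t)%:R <= `|alpha| * (size t)%:R.
  by rewrite ler_wpM2r// -normrN ler_norm.
lra.
Qed.

Lemma string_weight_extensions (U : set (set X)) (r : nat) : finite_set U ->
  exists2 C : R, 0 < C & forall s j,
    (\esum_(t in strings U r) string_weight f alpha phi (s ++ take j t)
     <= C%:E * string_weight f alpha phi s)%E.
Proof.
move=> finU; have finS := @finite_strings X U r finU.
pose c := expR ((`|alpha| + B) * r%:R).
pose S := \sum_(t \in strings U r) c.
have S0 : 0 <= S by apply: fsumr_ge0 => *; exact: expR_ge0.
(* The summand 1 keeps the constant positive even if there are no strings over [U]. *)
exists (1 + S); first lra.
move=> s j.
apply: (@le_trans _ _ (\esum_(t in strings U r)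
    (c%:E * string_weight f alpha phi s))%E).
  apply: le_esum => t [_ tr]; apply: le_trans (string_weight_cat _ _) _.
  apply: lee_wpmul2r; first exact: string_weight_ge0.
  rewrite lee_fin ler_expR; apply: ler_wpM2l.
    by rewrite addr_ge0.
  by rewrite ler_nat size_take_min tr geq_minr.
rewrite esum_fset//; last first.
  move=> t _; apply: mule_ge0; last exact: string_weight_ge0.
  by rewrite lee_fin expR_ge0.
rewrite -ge0_mule_fsuml; last by move=> t; rewrite lee_fin expR_ge0.
rewrite fsumEFin//; apply: lee_wpmul2r; first exact: string_weight_ge0.
by rewrite lee_fin -/S; lra.
Qed.

End extensions.

Section fpow_premeasure.
Context (R : realType) (X : Type) (f : nat -> X -> X) (m : nat).
Hypothesis hm : (0 < m)%N.
Hypothesis hper : forall n, f (n + m)%N = f n.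
Context (phi : X -> R) (B : R).
Hypothesis B0 : 0 <= B.
Hypothesis phiB : forall x, `|phi x| <= B.
Context (U : set (set X)).
Hypothesis finU : finite_set U.
Hypothesis covU : \bigcup_(A in U) A = setT.
Context (Z : set X) (theta : R).
Hypothesis htheta : 0 <= theta <= 1.

Let g := fpow f m.
Let psi := birkhoff f phi m.
Let V := block_cover f m U.

(* A string of length n is extended to the next multiple k * m of m. *)
Lemma premeasure_fpow_le (alpha : R) : exists2 C : R, 0 < C &
  forall N K, (N <= K * m < N + m)%N ->
  (premeasure g Z (m%:R * alpha) psi V K theta
   <= C%:E * premeasure f Z alpha phi U N theta)%E.
Proof.
have [C C0 hC] := string_weight_extensions f B0 phiB alpha m finU.
exists C => // N K /andP[NK KN].
(* [k n] is [n / m] rounded up, the number of blocks after extension. *)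
pose k n := ((n + m.-1) %/ m)%N.
pose ext s t := s ++ take (k (size s) * m - size s) t : seq (set X).
pose cut (s : seq (set X)) t := reshape (nseq (k (size s)) m) (ext s t).
have kn n : (n <= k n * m < n + m)%N.
  have := divn_eq (n + m.-1) m; have := ltn_pmod (n + m.-1) hm.
  by rewrite /k; lia.
have size_ext s t : strings U m t -> size (ext s t) = (k (size s) * m)%N.
  move=> [_ tm]; rewrite size_cat size_take_min tm.
  by have := kn (size s); lia.
have size_cut s t u : strings U m t -> u \in cut s t -> size u = m.
  move=> /size_ext szt uc.
  have : size u \in shape (cut s t) by apply: map_f.
  rewrite reshapeKl; first by rewrite mem_nseq => /andP[_ /eqP].
  by rewrite sumn_nseq szt mulnC.
have flatten_cut s t : strings U m t -> flatten (cut s t) = ext s t.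
  by move=> /size_ext szt; rewrite reshapeKr// sumn_nseq szt mulnC.
apply: (@premeasure_transfer _ _ f g _ _ _ _ _ _ _ _ _ _ _ (strings U m)
  (fun s t => map (string_set f) (cut s t))) => //.
  exact/finite_set_countable/finite_strings.
move=> s sU [Ns sN] _; split.
- move=> t tm; split.
    apply/string_inP => _ /mapP[u uc ->]; exists u => //; split.
      have : string_in U (flatten (cut s t)).
        rewrite flatten_cut//; apply: string_in_cat => //.
        by apply: string_in_take; case: tm.
      move=> /string_inP fU; apply/string_inP => A Au.
      by apply: fU; apply/flattenP; exists u.
    exact: size_cut uc.
  rewrite size_map size_reshape size_nseq; split.
    by have := kn (size s); nia.
  move=> theta_neq0; have [theta0 theta1] : 0 < theta /\ theta <= 1.
    by case/andP: htheta => ? ?; rewrite lt_def theta_neq0.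
  have m0 : (0 : R) < m%:R by rewrite ltr0n.
  (* In integers [k * m < n + m] means [k * m + 1 <= n + m]; this 1 cancels the one in
     [n < N / theta + 1]. *)
  have /andP[_] := kn (size s); rewrite -(ler_nat R) -addn1 !natrD natrM => kN.
  have : N%:R / theta <= K%:R * m%:R / theta.
    by rewrite ler_pM2r ?invr_gt0// -natrM ler_nat.
  have := sN theta_neq0 => sN' NK'.
  rewrite -(ltr_pM2r m0) mulrDl mul1r mulrAC; lra.
- rewrite (_ : \bigcup_(t in _) _ =
    \bigcup_(t in strings U m) string_set f (ext s t)).
    exact: string_set_extensions.
  apply: eq_bigcupr => t tm; rewrite string_set_fpow_flatten ?flatten_cut//.
  by move=> u; exact: size_cut.
- apply: le_trans (hC s (k (size s) * m - size s)%N).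
  apply: le_esum => t tm; rewrite string_weight_fpow_flatten//.
    by rewrite flatten_cut.
  by move=> u; exact: size_cut.
Qed.

(* A string of k blocks is extended to the length max(k * m, N); the shift from
   K to K.+1 absorbs the rounding in the upper bound N / theta + 1. *)
Lemma premeasure_le_fpow (alpha : R) : exists2 C : R, 0 < C &
  forall N K, (K.+1 * m <= N <= K.+2 * m)%N ->
  (premeasure f Z alpha phi U N theta
   <= C%:E * premeasure g Z (m%:R * alpha) psi V K theta)%E.
Proof.
(* There are at least [K] blocks and [N <= K.+2 * m], so at most [2 * m] entries are missing. *)
have [C C0 hC] := string_weight_extensions f B0 phiB alpha (2 * m) finU.
exists C => // N K /andP[KN NK].
(* Different strings may define the same member of [V]; [c] selects one of them. *)
have /choice[c hc] u :
    exists s, V u -> strings U m s /\ string_set f s = u.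
  have [[s sm su]|nVu] := pselect (V u); first by exists s.
  by exists [::] => /nVu.
pose lift (s : seq (set X)) := flatten (map c s).
have size_c (s : seq (set X)) : string_in V s ->
    forall u, u \in map c s -> size u = m.
  by move=> /string_inP sV _ /mapP[v /sV vV ->]; have [[]] := hc _ vV.
have size_lift s : string_in V s -> size (lift s) = (size s * m)%N.
  move=> /size_c sm; rewrite size_flatten /shape.
  have /all_pred1P -> : all (pred1 m) (map size (map c s)).
    by apply/allP => _ /mapP[u us ->] /=; exact/eqP/sm.
  by rewrite !size_map sumn_nseq mulnC.
have string_set_c (s : seq (set X)) : string_in V s ->
    map (string_set f) (map c s) = s.
  move=> /string_inP sV; rewrite -map_comp -[RHS]map_id.
  by apply/eq_in_map => u /sV/hc[].
apply: (@premeasure_transfer _ _ g f _ _ _ _ _ _ _ _ _ _ _ (strings U (2 * m))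
  (fun s t => lift s ++ take (N - size s * m) t)) => //.
  exact/finite_set_countable/finite_strings.
move=> s sV [Ks sK] _; split.
- move=> t [tU tm]; split.
    apply: string_in_cat; last exact: string_in_take.
    apply/string_inP => A /flattenP[_ /mapP[u us ->]].
    by have /string_inP/(_ _ us)/hc[[/string_inP cU _ _]] := sV; exact: cU.
  have -> : size (lift s ++ take (N - size s * m) t) = maxn (size s * m) N.
    rewrite size_cat size_lift// size_take_min tm.
    rewrite (minn_idPl _) -?maxnE//; nia.
  split; first exact: leq_maxr.
  move=> theta_neq0; have [theta0 theta1] : 0 < theta /\ theta <= 1.
    by case/andP: htheta => ? ?; rewrite lt_def theta_neq0.
  have m0 : (0 : R) < m%:R by rewrite ltr0n.
  have thetaV1 : 1 <= theta^-1 by rewrite invf_ge1.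
  have KN' : (K%:R + 1) * m%:R <= N%:R :> R by rewrite natr1 -natrM ler_nat.
  have := sK theta_neq0; rewrite -(ltr_pM2r m0) => sK'.
  (* Hence [size s * m < K * m / theta + m <= (K + 1) * m / theta <= N / theta]. *)
  have mV : m%:R <= m%:R / theta by rewrite ler_peMr// ltW.
  have NV : N%:R <= N%:R / theta by rewrite ler_peMr.
  have KNV : (K%:R + 1) * m%:R / theta <= N%:R / theta.
    by rewrite ler_pM2r ?invr_gt0.
  by rewrite natr_max gt_max natrM; apply/andP; split; lra.
- rewrite -{1}(string_set_c _ sV) string_set_fpow_flatten//; last exact: size_c.
  exact: string_set_extensions.
- apply: le_trans (hC (lift s) (N - size s * m)%N) _.
  rewrite -{2}(string_set_c _ sV) string_weight_fpow_flatten//.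
  exact: size_c.
Qed.

End fpow_premeasure.

(** * Pressures of the power system for a single cover *)

Section fpow_pressure.
Context (R : realType) (X : Type) (f : nat -> X -> X) (m : nat).
Hypothesis hm : (0 < m)%N.
Hypothesis hper : forall n, f (n + m)%N = f n.
Context (phi : X -> R) (B : R).
Hypothesis B0 : 0 <= B.
Hypothesis phiB : forall x, `|phi x| <= B.
Context (U : set (set X)).
Hypothesis finU : finite_set U.
Hypothesis covU : \bigcup_(A in U) A = setT.
Context (Z : set X) (theta : R).
Hypothesis htheta : 0 <= theta <= 1.

Let m0 : (0 : R) < m%:R. Proof. by rewrite ltr0n. Qed.

(** Scaling by [m] is a bijection of the real exponents, so it remains to show that the limits of
    the premeasures vanish at [a] and at [m%:R * a] together. *)
Let ereal_infM (P Q : set R) : (forall a, P a <-> Q (m%:R * a)) ->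
  ereal_inf [set a%:E | a in Q] = (m%:R%:E * ereal_inf [set a%:E | a in P])%E.
Proof.
move=> PQ; rewrite -ereal_inf_pZl//; congr ereal_inf; apply/seteqP; split.
  move=> _ [b Qb <-]; exists (m%:R^-1 * b)%:E.
    by exists (m%:R^-1 * b) => //; apply/PQ; rewrite mulVKf// gt_eqF.
  by rewrite -EFinM mulVKf// gt_eqF.
by move=> _ [_ [a Pa <-] <-]; exists (m%:R * a) => //; exact/PQ.
Qed.

Lemma lower_pressure_cover_fpow :
  lower_pressure_cover (fpow f m) Z (birkhoff f phi m) theta (block_cover f m U)
  = (m%:R%:E * lower_pressure_cover f Z phi theta U)%E.
Proof.
apply: ereal_infM => a; split.
- have [C C0 hC] :=
    premeasure_fpow_le hm hper B0 phiB finU covU Z htheta a.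
  apply: (limn_einf_eq0_transfer (sigma := fun N => ((N + m.-1) %/ m)%N) C0).
  + by move=> n; exact: premeasure_ge0.
  + by move=> n; exact: premeasure_ge0.
  + move=> n; exists (n * m)%N => k nk.
    by rewrite leq_divRL//; exact: leq_trans (leq_addr _ _).
  + move=> k; apply: hC.
    by have := divn_eq (k + m.-1) m; have := ltn_pmod (k + m.-1) hm; lia.
- have [C C0 hC] :=
    premeasure_le_fpow hm hper B0 phiB finU covU Z htheta a.
  apply: (limn_einf_eq0_transfer (sigma := fun K => (K.+1 * m)%N) C0).
  + by move=> n; exact: premeasure_ge0.
  + by move=> n; exact: premeasure_ge0.
  + by move=> n; exists n => k nk; nia.
  + by move=> k; apply: hC; nia.
Qed.

Lemma upper_pressure_cover_fpow :
  upper_pressure_cover (fpow f m) Z (birkhoff f phi m) theta (block_cover f m U)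
  = (m%:R%:E * upper_pressure_cover f Z phi theta U)%E.
Proof.
apply: ereal_infM => a; split.
- have [C C0 hC] :=
    premeasure_fpow_le hm hper B0 phiB finU covU Z htheta a.
  apply: (limn_esup_eq0_transfer (tau := fun K => (K * m)%N) (n0 := 0%N) C0).
  + by move=> n; exact: premeasure_ge0.
  + by move=> n; exact: premeasure_ge0.
  + by move=> n; exists n => k nk; nia.
  + by move=> k _; apply: hC; lia.
- have [C C0 hC] :=
    premeasure_le_fpow hm hper B0 phiB finU covU Z htheta a.
  (* Every [N >= m] lies between [q * m] and [q.+1 * m] for [q = N %/ m], so [K = q.-1] serves;
     [N >= m] makes [q] positive, so the predecessor is not truncated. *)
  apply: (limn_esup_eq0_transfer (tau := fun N => (N %/ m).-1) (n0 := m) C0).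
  + by move=> n; exact: premeasure_ge0.
  + by move=> n; exact: premeasure_ge0.
  + move=> n; exists (n.+1 * m)%N => k.
    by rewrite -leq_divRL//; lia.
  + move=> N mN; apply: hC.
    have := divn_eq N m; have := ltn_pmod N hm.
    have : (0 < N %/ m)%N by rewrite divn_gt0.
    by case: (N %/ m)%N => //= q _; nia.
Qed.

End fpow_pressure.

(** * Pressure of a cover under refinement *)

Section refinement.
Context (R : realType) (X : Type) (f : nat -> X -> X) (Z : set X).
Context (phi : X -> R) (theta : R).
Context (U V : set (set X)) (e : R).
Hypothesis VU : forall A, V A -> A !=set0 -> exists2 A', U A' & A `<=` A'.
Hypothesis oscU : forall A x y, U A -> A x -> A y -> phi x <= phi y + e.

(** Each entry is replaced by a member of [U] containing it. This enlarges the string set, but the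
    Birkhoff sum grows by at most [e] per entry, which the exponent [alpha + e] absorbs. *)
Lemma premeasure_refine (alpha : R) (N : nat) :
  (premeasure f Z (alpha + e) phi U N theta
   <= 1%:E * premeasure f Z alpha phi V N theta)%E.
Proof.
have /choice[h hh] A : exists A', V A -> A !=set0 -> U A' /\ A `<=` A'.
  have [VA|] := pselect (V A); last by exists set0.
  have [A0|] := pselect (A !=set0); last by exists set0.
  by have [A' ? ?] := VU VA A0; exists A'.
apply: (@premeasure_transfer _ _ f f _ _ _ _ _ _ _ _ _ _ _ [set tt]
  (fun s _ => map h s)) => //.
move=> s sV sN [y ys].
have hs j : (j < size s)%N -> U (h (nth set0 s j)) /\
    nth set0 s j `<=` h (nth set0 s j).
  by move=> js; apply: hh; [exact: sV|exists (compn f 0 j y); exact: ys].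
have sub : string_set f s `<=` string_set f (map h s).
  move=> x xs j; rewrite size_map => js; rewrite (nth_map set0)//.
  by apply: (hs j js).2; exact: xs.
split.
- move=> _ _; rewrite size_map; split => // j; rewrite size_map => js.
  by rewrite (nth_map set0)//; exact: (hs j js).1.
- by move=> x /sub ?; exists tt.
- rewrite esum_set1 ?string_weight_ge0// mul1e /string_weight lee_expeR.
  rewrite size_map.
  (* The point [y] of the original string set is the reference: any [x] in the enlarged set shares a
     member of [U] with [y] at every time. *)
  apply: (@le_trans _ _ ((- ((alpha + e) * (size s)%:R))%:E +
      ((size s)%:R * e + birkhoff f phi (size s) y)%:E)%E).
    rewrite leeD2l//; apply: ge_ereal_sup => _ [x xs <-].
    rewrite lee_fin /birkhoff; apply: le_trans (_ : \sum_(j < size s)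
        (e + phi (compn f 0 j y)) <= _); last first.
      by rewrite big_split sumr_const card_ord mulr_natl.
    apply: ler_sum => j _; rewrite addrC; have [Uh sh] := hs j (ltn_ord j).
    apply: (oscU Uh); last exact/sh/ys.
    by have := xs j; rewrite size_map (nth_map set0)//; apply.
  rewrite -EFinD (_ : _ + _ = - (alpha * (size s)%:R) +
      birkhoff f phi (size s) y); last by ring.
  by rewrite EFinD leeD2l//; apply: ereal_sup_ubound; exists y.
Qed.

Let ereal_inf_shift (P Q : set R) : (forall a, Q a -> P (a + e)) ->
  (ereal_inf [set a%:E | a in P] <= ereal_inf [set a%:E | a in Q] + e%:E)%E.
Proof.
move=> QP; rewrite -leeBlDr//; apply: le_ereal_inf_tmp => _ [a Qa <-].
rewrite leeBlDr// -EFinD; apply: ereal_inf_lbound; exists (a + e) => //.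
exact: QP.
Qed.

Lemma lower_pressure_cover_refine :
  (lower_pressure_cover f Z phi theta U
   <= lower_pressure_cover f Z phi theta V + e%:E)%E.
Proof.
apply: ereal_inf_shift => a /=.
apply: (limn_einf_eq0_transfer (sigma := id) ltr01).
- by move=> n; exact: premeasure_ge0.
- by move=> n; exact: premeasure_ge0.
- by move=> n; exists n.
- by move=> k; exact: premeasure_refine.
Qed.

Lemma upper_pressure_cover_refine :
  (upper_pressure_cover f Z phi theta U
   <= upper_pressure_cover f Z phi theta V + e%:E)%E.
Proof.
apply: ereal_inf_shift => a /=.
apply: (limn_esup_eq0_transfer (tau := id) (n0 := 0%N) ltr01).
- by move=> n; exact: premeasure_ge0.
- by move=> n; exact: premeasure_ge0.
- by move=> n; exists n.
- by move=> k _; exact: premeasure_refine.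
Qed.

End refinement.

(** * Finite open covers of small mesh *)

Lemma mdist_le_diam (R : realType) (X : metricType R) (A : set X) (x y : X) :
  A x -> A y -> ((mdist x y)%:E <= diam A)%E.
Proof.
move=> Ax Ay; rewrite /diam le_max; apply/orP; right.
by apply: ereal_sup_ubound; exists (x, y).
Qed.

Lemma subset_diam (R : realType) (X : metricType R) (A B : set X) :
  A `<=` B -> (diam A <= diam B)%E.
Proof.
move=> AB; rewrite /diam ge_max le_max lexx/=; apply: ge_ereal_sup.
by move=> _ [[x y] [/= /AB Bx /AB By] <-]; exact: mdist_le_diam.
Qed.

Lemma diam_le_mesh (R : realType) (X : metricType R) (U : set (set X))
    (A : set X) : U A -> (diam A <= mesh U)%E.
Proof. by move=> UA; apply: ereal_sup_ubound; exists A. Qed.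

Section compact_mesh.
Context (R : realType) (X : metricType R).
Hypothesis hX : compact [set: X].

(** Lebesgue number lemma: compactness yields one radius [d] such that every [d]-ball lies in a
    member of [O], and a nonempty set of diameter below [d] lies in the ball around any of its
    points. *)
Lemma near_mesh_to0_subordinate (O : set (set X)) :
  (forall A, O A -> open A) -> \bigcup_(A in O) A = setT ->
  \forall V \near @mesh_to0 R X,
    forall A, V A -> A !=set0 -> exists2 B, O B & A `<=` B.
Proof.
move=> oO OT.
have H : \forall d \near (0 : R)^'+,
    [set: X] `<=` (fun x => exists2 B, O B & ball x d `<=` B).
  apply: (iffLR (compact_near_coveringP _) hX) => x _.
  have [B OB Bx] : (\bigcup_(A in O) A) x by rewrite OT.
  have /nbhs_ballP[r /= r0 rB] : nbhs x B.
    by apply: open_nbhs_nbhs; split => //; exact: oO.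
  exists (ball x (r / 2), [set d | d < r / 2]) => /=.
    split; first exact/nbhsx_ballx/divr_gt0.
    by apply: nbhs_right_lt; exact: divr_gt0.
  move=> [y d] [/= xy dr]; exists B => // z yz; apply: rB.
  rewrite (splitr r); apply: ball_triangle xy _.
  exact: le_ball (ltW dr) _ yz.
have [d [Hd d0]] := filter_ex (filterI H (nbhs_right_gt 0)).
exists d => // V [_ Vd] A VA [x Ax].
have [B OB dB] := Hd x I; exists B => // y Ay; apply: dB.
rewrite ballEmdist /= -lte_fin.
apply: le_lt_trans (mdist_le_diam Ax Ay) _.
exact: le_lt_trans (diam_le_mesh VA) Vd.
Qed.

(** Compactness provides finite open covers of arbitrarily small mesh. Interiors of balls of radius
    [d / 3] have diameter at most [2 * d / 3], strictly below [d]. *)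
Lemma mesh_to0_proper : ProperFilter (@mesh_to0 R X).
Proof.
apply: filter_from_proper => d /= d0.
have d30 : 0 < d / 3 by apply: divr_gt0.
pose b (x : X) := (ball x (d / 3))°.
(* Along the filter of finite sets ordered by inclusion, the near-covering property is the existence
   of a finite set of centres. *)
pose F := filter_from [set A : set X | finite_set A]
  (fun A => [set B | finite_set B /\ A `<=` B]).
have FF : Filter F.
  apply: filter_from_filter; first by exists set0; exact: finite_set0.
  move=> A A' fA fA'; exists (A `|` A'); first by rewrite /= finite_setU.
  by move=> C [fC]; rewrite subUset => -[].
have [A /= fA Acov] : \forall A \near F,
    [set: X] `<=` (fun x => exists2 a, A a & b a x).
  apply: (iffLR (compact_near_coveringP _) hX) => x _.
  exists (b x, [set A | A x]) => /=.
    split; first by apply: nbhs_interior; exact: nbhsx_ballx.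
    by exists [set x]; [exact: finite_set1|move=> A [_]; exact].
  by move=> [y A] [/= xy Ax]; exists x.
exists (b @` A); split.
  split; first exact: finite_image.
    by move=> _ [x _ <-]; exact: open_interior.
  apply/seteqP; split => // x _.
  have [a Aa ax] := Acov A (conj fA (@subset_refl _ A)) x I.
  by exists (b a) => //; exists a.
apply: (@le_lt_trans _ _ (2 * (d / 3))%:E); last by rewrite lte_fin; lra.
apply: ge_ereal_sup => _ [_ [x _ <-] <-]; rewrite /diam ge_max lee_fin.
apply/andP; split; first lra.
apply: ge_ereal_sup.
move=> _ [[y z] [/= /interior_subset xy /interior_subset xz] <-].
move: xy xz; rewrite ballEmdist /= lee_fin => xy xz.
by have := metric_triangle y x z; rewrite (metric_sym y x); lra.
Qed.

(** Uniform continuity in terms of covers: fine covers are subordinate to the preimages of balls of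
    radius [e / 2]. *)
Lemma near_mesh_to0_oscillation (phi : X -> R) (e : R) :
  continuous phi -> 0 < e ->
  \forall U \near @mesh_to0 R X,
    forall A x y, U A -> A x -> A y -> phi x <= phi y + e.
Proof.
move=> cphi e0.
have : \forall V \near @mesh_to0 R X, forall A, V A -> A !=set0 ->
    exists2 B, range (fun x => phi @^-1` (ball (phi x) (e / 2))) B & A `<=` B.
  apply: near_mesh_to0_subordinate.
    move=> _ [x _ <-]; apply: open_comp; first by move=> z _; exact: cphi.
    exact: ball_open.
  apply/seteqP; split => // x _.
  exists (phi @^-1` (ball (phi x) (e / 2))); first by exists x.
  by apply: ballxx; exact: divr_gt0.
apply: filterS => U hU A x y UA Ax Ay.
have [|_ [z _ <-] AB] := hU A UA; first by exists x.
have := AB _ Ax; have := AB _ Ay; rewrite /ball /= !ltr_norml; lra.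
Qed.

End compact_mesh.

(** * Limits over finite open covers *)

(** The limit is the supremum [l] of the eventual lower bounds of [p]. By hypothesis [p U - e] is
    such a bound for [U] far along the filter, so [p] is eventually at most [l + e]. *)
Lemma is_cvg_ereal_almost_decreasing (R : realType) (T : Type)
    (F : set_system T) (FF : ProperFilter F) (p : T -> \bar R) :
  (forall e : R, 0 < e -> \forall U \near F, \forall V \near F,
     (p U <= p V + e%:E)%E) ->
  cvg (p U @[U --> F]).
Proof.
move=> H; pose l := ereal_sup [set y | \forall V \near F, (y <= p V)%E].
have le_l (e : R) : 0 < e -> \forall U \near F, (p U <= l + e%:E)%E.
  move=> e0; apply: filterS (H e e0) => U HU.
  rewrite -leeBlDr//; apply: ereal_sup_ubound.
  by apply: filterS HU => V; rewrite leeBlDr.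
have lt_l y : (y < l)%E -> \forall U \near F, (y < p U)%E.
  move=> /ereal_sup_gt[z Fz yz]; apply: filterS Fz => V; exact: lt_le_trans.
apply/cvg_ex; exists l; case: l le_l lt_l => [r||] le_l lt_l A.
- move=> rA; have /nbhs_ballP[e /= e0 eA] : nbhs r (fun x => A x%:E) := rA.
  have e20 : 0 < e / 2 by apply: divr_gt0.
  have lre : ((r - e)%:E < r%:E)%E by rewrite lte_fin; lra.
  apply: filterS2 (le_l _ e20) (lt_l _ lre) => U; rewrite /= -EFinD.
  case: (p U) => [x||]//; rewrite lee_fin lte_fin => xr rx.
  by apply: (eA x); rewrite -ball_normE /= ltr_norml; lra.
- move=> [M [_ MA]]; apply: filterS (lt_l M%:E (ltry _)) => U; exact: MA.
- move=> [M [_ MA]]; apply: filterS (le_l _ ltr01) => U.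
  rewrite leeNy_eq => /eqP pU; apply: MA; rewrite pU; exact: ltNyr.
Qed.

(** * Block covers along the filter of fine covers *)

Section block_cover.
Context (R : realType) (X : metricType R) (f : nat -> X -> X).
Hypothesis hf : forall i, continuous (f i).
Context (m : nat).
Hypothesis hm : (0 < m)%N.

Lemma continuous_compn (i n : nat) : continuous (compn f i n).
Proof.
elim: n => [|n IH] x /=; first exact: cvg_id.
by apply: continuous_comp; [exact: IH|exact: hf].
Qed.

Lemma continuous_birkhoff (phi : X -> R) (n : nat) :
  continuous phi -> continuous (birkhoff f phi n).
Proof.
move=> cphi; elim: n => [|n IH] x.
  rewrite (_ : birkhoff f phi 0 = cst 0); first exact: cvg_cst.
  by apply/funext => y; rewrite /birkhoff big_ord0.
rewrite (_ : birkhoff f phi n.+1 =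
    birkhoff f phi n \+ (phi \o compn f 0 n)).
  apply: cvgD; first exact: IH.
  by apply: continuous_comp; [exact: continuous_compn|exact: cphi].
by apply/funext => y; rewrite /birkhoff big_ord_recr.
Qed.

Lemma open_string_set (U : set (set X)) (s : seq (set X)) :
  (forall A, U A -> open A) -> string_in U s -> open (string_set f s).
Proof.
move=> oU /string_inP sU.
have {sU oU} : forall A, A \in s -> open A by move=> A /sU /oU.
elim/last_ind: s => [_|s A IH os].
  by rewrite (_ : string_set f [::] = setT); [exact: openT|apply/seteqP; split].
rewrite (_ : string_set f _ = string_set f s `&` compn f 0 (size s) @^-1` A).
  apply: openI.
    by apply: IH => B Bs; apply: os; rewrite mem_rcons inE Bs orbT.
  apply: open_comp; first by move=> x _; exact: continuous_compn.
  by apply: os; rewrite mem_rcons mem_head.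
rewrite -cats1; apply/seteqP; split => x.
  by move=> /(string_setP _ _ _ erefl)[xs /(_ 0%N erefl)]; rewrite addn0.
move=> [xs xA]; apply/(string_setP _ _ _ erefl); split => // -[|j]//= _.
by rewrite addn0.
Qed.

Lemma finite_open_cover_block (U : set (set X)) :
  finite_open_cover U -> finite_open_cover (block_cover f m U).
Proof.
move=> [finU oU covU]; split.
- exact/finite_image/finite_strings.
- by move=> _ [s [sU _] <-]; exact: open_string_set sU.
- apply/seteqP; split => // x _.
  (* Strings of length [m] are the extensions of the empty string by [m] entries. *)
  have [|t tm xt] := @string_set_extensions X f U m m [::] covU x; first by [].
  exists (string_set f t); first by exists t.
  by move: xt; rewrite take_oversize//; case: tm => _ ->.
Qed.

(** Each member lies in the first entry of its string, which exists because [m > 0]. *)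
Lemma mesh_block_cover (U : set (set X)) :
  (mesh (block_cover f m U) <= mesh U)%E.
Proof.
apply: ge_ereal_sup => _ [_ [s [sU sm] <-] <-].
apply: le_trans (diam_le_mesh (sU 0%N _)); last by rewrite sm.
by apply: subset_diam => x /(_ 0%N); rewrite sm; exact.
Qed.

Lemma cvg_block_cover :
  block_cover f m U @[U --> @mesh_to0 R X] --> @mesh_to0 R X.
Proof.
move=> P [d d0 dP]; exists d => // U [cU Ud]; apply: dP.
split; first exact: finite_open_cover_block.
exact: le_lt_trans (mesh_block_cover U) Ud.
Qed.

(* Passing to the limit in [q (block_cover f m U) = m * p U] needs the limit
   of [q] to exist: [lim] is an arbitrary value otherwise. *)
Lemma lim_block_cover (p q : set (set X) -> \bar R) : compact [set: X] ->
  (forall U, finite_open_cover U -> q (block_cover f m U) = m%:R%:E * p U)%E ->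
  cvg (q U @[U --> @mesh_to0 R X]) ->
  lim (q U @[U --> @mesh_to0 R X])
    = (m%:R%:E * lim (p U @[U --> @mesh_to0 R X]))%E.
Proof.
move=> hX qp /cvg_ex[/= l ql]; have PF := mesh_to0_proper hX.
have m0 : (m%:R : R) != 0 by rewrite pnatr_eq0 -lt0n.
rewrite (cvg_lim _ ql)//.
suff pl : p U @[U --> @mesh_to0 R X] --> ((m%:R^-1)%:E * l)%E.
  by rewrite (cvg_lim _ pl)// muleA -EFinM divff// mul1e.
(* For an open cover, [p U] is [q (block_cover f m U)] divided by [m], and block covers become fine
   as [U] does; so [p] inherits convergence from [q]. *)
have : ((m%:R^-1)%:E * q (block_cover f m U))%E @[U --> @mesh_to0 R X]
    --> ((m%:R^-1)%:E * l)%E.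
  by apply: cvgeZl => //; exact: cvg_comp cvg_block_cover ql.
apply: cvg_trans; apply: near_eq_cvg; exists 1 => /= [//|U [cU _] /=].
by rewrite qp// muleA -EFinM mulVf// mul1e.
Qed.

End block_cover.

Lemma compact_continuous_bound (R : realType) (X : topologicalType)
    (phi : X -> R) : compact [set: X] -> continuous phi ->
  exists2 B : R, 0 <= B & forall x, `|phi x| <= B.
Proof.
move=> hX cphi.
have : bounded_set (phi @` [set: X]).
  apply/compact_bounded/continuous_compact => //.
  exact: continuous_subspaceT.
move=> /ex_strict_bound_gt0[B B0 hB]; exists B; first exact: ltW.
by move=> x; apply/ltW/hB; exists x.
Qed.

Theorem proposition3p3 (R : realType) (X : metricType R)
    (hX : compact [set: X]) (f : nat -> X -> X)
    (hf : forall i, continuous (f i)) (m : nat) (hm : (0 < m)%N)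
    (hper : forall n, f (n + m)%N = f n)
    (Z : set X) (phi : X -> R) (hphi : continuous phi)
    (theta : R) (htheta : 0 <= theta <= 1) :
  lower_pressure (fpow f m) Z (birkhoff f phi m) theta
    = (m%:R%:E * lower_pressure f Z phi theta)%E /\
  upper_pressure (fpow f m) Z (birkhoff f phi m) theta
    = (m%:R%:E * upper_pressure f Z phi theta)%E.
Proof.
have PF := mesh_to0_proper hX.
have [B B0 phiB] := compact_continuous_bound hX hphi.
have cpsi := @continuous_birkhoff R X f hf phi m hphi.
have near_cover : \forall U \near @mesh_to0 R X, finite_open_cover U.
  by exists 1 => /= [//|U []].
split; apply: (lim_block_cover hf hm hX).
- move=> U [finU _ covU].
  by rewrite (lower_pressure_cover_fpow hm hper B0 phiB finU covU Z htheta).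
(* The convergent side is that of the power system, so the oscillation to control is that of its
   potential [birkhoff f phi m]. *)
- apply: is_cvg_ereal_almost_decreasing => e e0.
  apply: filterS2 (near_mesh_to0_oscillation hX cpsi e0) near_cover.
  move=> U oscU [finU oU covU].
  apply: filterS (near_mesh_to0_subordinate hX oU covU) => V VU.
  exact: lower_pressure_cover_refine.
- move=> U [finU _ covU].
  by rewrite (upper_pressure_cover_fpow hm hper B0 phiB finU covU Z htheta).
- apply: is_cvg_ereal_almost_decreasing => e e0.
  apply: filterS2 (near_mesh_to0_oscillation hX cpsi e0) near_cover.
  move=> U oscU [finU oU covU].
  apply: filterS (near_mesh_to0_subordinate hX oU covU) => V VU.
  exact: upper_pressure_cover_refine.
Qed.
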